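(* Let $\mathcal B$ be a locally finite thick affine building of type $\widetilde A_2$ and let $\Gamma$ be a group of type rotating automorphisms of $\mathcal B$ acting freely and transitively on the vertex set of $\mathcal B$. Let $\mathcal T$ be the associated set of triangle labellings. Then for any two triangle labellings $I,F\in\mathcal T$ there is a row sequence of labelled triangles along some wall of $\mathcal B$ whose initial triangle has labelling $I$ and whose final triangle has labelling $F$. Explicitly: there exist an integer $n\ge 2$, an apartment chart $\varphi:\mathbb Z^2\to\Gamma$, and triples $(b^{(i)},b^{(i)}_2,b^{(i)}_3)\in\mathcal T$ for $1\le i\le n$, with $(b^{(1)},b^{(1)}_2,b^{(1)}_3)=I$ and $(b^{(n)},b^{(n)}_2,b^{(n)}_3)=F$, such that for every $1\le i\le n$ $$\varphi(i,0)=\varphi(i-1,0)\,b^{(i)},\qquad \varphi(i-1,1)=\varphi(i,0)\,b^{(i)}_2,\qquad \varphi(i-1,0)=\varphi(i-1,1)\,b^{(i)}_3 .$$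
   Context: Building. Each vertex $v$ of $\mathcal B$ has a type $\tau(v)\in\mathbb Z/3\mathbb Z$, each chamber (triangle) having exactly one vertex of each type. An automorphism $\alpha$ of $\mathcal B$ is type rotating if there is $i\in\mathbb Z/3\mathbb Z$ with $\tau(\alpha(v))=\tau(v)+i$ for all vertices $v$. Labels. Fix a base vertex $o$ and identify the vertex set of $\mathcal B$ with $\Gamma$ via $g\leftrightarrow g\,o$. Let $P\subset\Gamma$ be the (finite) set of $x\in\Gamma$ such that $x\,o$ is adjacent to $o$ and $\tau(x\,o)=\tau(o)+1$. Then the neighbours of a vertex $g$ are the vertices $gx$ and $gx^{-1}$ with $x\in P$; the edge from $g$ to $gx$ is directed and labelled by $x$. Put $\mathcal T=\{(x,y,z)\in P^3: xyz=1\}$. The elements of $\mathcal T$ are called triangle labellings; going round a triangle of $\mathcal B$ along its directed edges one reads an element of $\mathcal T$ (depending on the starting vertex). Charts. Make $\mathbb Z^2$ the vertex set of the triangulated plane in which $m,m'$ are adjacent iff $m-m'\in\{\pm(1,0),\pm(0,1),\pm(1,-1)\}$ (the tiling by equilateral triangles). An apartment chart is a map $\varphi:\mathbb Z^2\to\Gamma$ that is a simplicial isomorphism from this triangulated plane onto an apartment of $\mathcal B$. The wall in question is the line $\varphi(\mathbb Z\times\{0\})$, and the triangles of the row are $\{\varphi(i-1,0),\varphi(i,0),\varphi(i-1,1)\}$, $1\le i\le n$: consecutive triangles with an edge on the wall, all on the same side of it, each labelled $(b,b_2,b_3)$ with $b$ on the wall edge directed left to right, $b_2$ on the right edge directed from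 the wall to the apex, and $b_3$ on the left edge directed from the apex to the wall. *)

(* Defs.v *)
From mathcomp Require Import all_boot all_order all_algebra finmap.
From mathcomp Require Import boolp classical_sets functions cardinality.

Set Implicit Arguments.
Unset Strict Implicit.
Unset Printing Implicit Defensive.

Import GRing.Theory.

Local Open Scope fset_scope.

(* Abstract simplicial complexes, given by their set of (nonempty) simplices. *)

Definition simplicial_complex (V : choiceType) (X : set {fset V}) : Prop :=
  ~ X fset0 /\
  forall s t : {fset V}, X s -> t `<=` s -> t != fset0 -> X t.

Definition vertices (V : choiceType) (X : set {fset V}) : set V :=
  [set v | X [fset v]]%classic.

Definition adjacent (V : choiceType) (X : set {fset V}) (u v : V) : Prop :=
  u != v /\ X [fset u; v].

Definition simplicial_iso (V W : choiceType) (X : set {fset V})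
    (Y : set {fset W}) (f : V -> W) : Prop :=
  set_bij (vertices X) (vertices Y) f /\
  forall s : {fset V}, (forall v, v \in s -> vertices X v) ->
    (X s <-> Y [fset f v | v in s]).

(* The tiling of the plane by equilateral triangles, which is the Coxeter
   complex of type A~2; its simplices are the nonempty cliques of the
   adjacency graph on Z^2. *)

Definition plane_adj (m m' : int * int) : bool :=
  (m - m')%R \in
    [:: (1, 0); (-1, 0); (0, 1); (0, -1); (1, -1); (-1, 1)]%R.

Definition plane : set {fset int * int} :=
  [set s | s != fset0 /\
           forall m m', m \in s -> m' \in s -> m != m' -> plane_adj m m']%classic.

(* The three conjuncts of [apartment_system] are the usual building axioms
   (B0), (B1), (B2) for the Coxeter type A~2. *)

Definition apartment_system (V : choiceType) (X : set {fset V})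
    (A : set (set {fset V})) : Prop :=
  [/\ forall S, A S ->
        [/\ (S `<=` X)%classic, simplicial_complex S &
            exists f : int * int -> V, simplicial_iso plane S f],
      forall a b, X a -> X b -> exists S, [/\ A S, S a & S b] &
      forall S S', A S -> A S' ->
        forall a b, S a -> S b -> S' a -> S' b ->
        exists f : V -> V, simplicial_iso S S' f /\
          forall v, v \in a `|` b -> f v = v].

Definition building_A2 (V : choiceType) (X : set {fset V}) : Prop :=
  [/\ simplicial_complex X, forall v : V, X [fset v] &
      exists A, apartment_system X A].

(* Membership in the complete apartment system, i.e. in the union of all
   apartment systems. *)
Definition apartment (V : choiceType) (X S : set {fset V}) : Prop :=
  exists A, apartment_system X A /\ A S.

Definition chamber (V : choiceType) (X : set {fset V}) (c : {fset V}) : Prop :=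
  X c /\ #|` c| = 3.

Definition panel (V : choiceType) (X : set {fset V}) (e : {fset V}) : Prop :=
  X e /\ #|` e| = 2.

Definition thick (V : choiceType) (X : set {fset V}) : Prop :=
  forall e, panel X e -> exists c1 c2 c3,
    [/\ chamber X c1, chamber X c2 & chamber X c3] /\
    [/\ e `<=` c1, e `<=` c2 & e `<=` c3] /\
    [/\ c1 != c2, c1 != c3 & c2 != c3].

Definition locally_finite (V : choiceType) (X : set {fset V}) : Prop :=
  forall v : V, finite_set [set s | X s /\ v \in s]%classic.

Definition type_function (V : choiceType) (X : set {fset V})
    (tau : V -> 'Z_3) : Prop :=
  forall c, chamber X c -> forall i : 'Z_3,
    exists! v, v \in c /\ tau v = i.

Definition automorphism (V : choiceType) (X : set {fset V})
    (f : V -> V) : Prop :=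
  bijective f /\ forall s : {fset V}, X s <-> X [fset f v | v in s].

Definition type_rotating (V : choiceType) (tau : V -> 'Z_3)
    (f : V -> V) : Prop :=
  exists i : 'Z_3, forall v, tau (f v) = (tau v + i)%R.

Definition group_action (G : groupType) (V : choiceType)
    (act : G -> V -> V) : Prop :=
  (forall v, act 1%g v = v) /\
  forall g h v, act (g * h)%g v = act g (act h v).

Definition free_action (G : groupType) (V : choiceType)
    (act : G -> V -> V) : Prop :=
  forall g v, act g v = v -> g = 1%g.

Definition transitive_action (G : groupType) (V : choiceType)
    (act : G -> V -> V) : Prop :=
  forall u v, exists g, act g u = v.

Definition label_set (G : groupType) (V : choiceType) (X : set {fset V})
    (tau : V -> 'Z_3) (act : G -> V -> V) (o : V) : set G :=
  [set x | adjacent X (act x o) o /\ tau (act x o) = (tau o + 1)%R]%classic.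

Definition triangle_labellings (G : groupType) (V : choiceType)
    (X : set {fset V}) (tau : V -> 'Z_3) (act : G -> V -> V) (o : V) :
    set (G * G * G) :=
  [set t | let: (x, y, z) := t in
    [/\ label_set X tau act o x, label_set X tau act o y,
        label_set X tau act o z & (x * y * z)%g = 1%g]]%classic.

(* A chart takes values in the group, whose elements stand for the vertices
   [act g o]. *)
Definition apartment_chart (G : groupType) (V : choiceType)
    (X : set {fset V}) (act : G -> V -> V) (o : V)
    (phi : int * int -> G) : Prop :=
  exists S, apartment X S /\
    simplicial_iso plane S (fun m => act (phi m) o).

(* Main.v *)
(* A row of triangles along a wall is a strip of the plane: reading its vertices
   alternately on the two walls of the strip gives a sequence v_0, v_1, ... in
   which three consecutive vertices form a chamber and v_k <> v_(k+3). Since the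
   corresponding galleries are straight, hence geodesic, every such sequence lies
   in an apartment, so that a row sequence is the same as a walk on T with steps
     (b, b2, b3) -> (b', b2', b3')  iff  (b2, x, b3') in T for some x,
                                          b3' <> b and b' <> b2.
   The link of a vertex is a projective plane with points P and lines P, the
   point a lying on the line c iff (a, x, c) is in T for some x. From (b, b2, b3)
   one can step to exactly one triple (b', _, _) for each point b' off the line b,
   the new line b3' being the join of b' and b2. In- and out-degrees are both
   equal to q^2, so a set C of triples closed under steps is also closed under
   backward steps. Two triples with the same middle label have a common
   successor, so membership in C only depends on the middle label; hence all points
   other than b' of a line b3' through b' behave alike, and since lines have at
   least three points, so do any two points. *)
Require Import Defs.
From mathcomp Require Import all_boot all_order all_algebra finmap.
From mathcomp Require Import boolp classical_sets functions cardinality.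
From mathcomp Require Import zify ring.

Set Implicit Arguments.
Unset Strict Implicit.
Unset Printing Implicit Defensive.

Import Order.TTheory GRing.Theory Num.Theory.

Local Open Scope fset_scope.
Local Open Scope ring_scope.

(** * The triangulated plane *)

(* The quadratic form of the A~2 root lattice: adjacency in the plane is
   distance 1, which makes it invariant under the affine maps below. *)
Definition hexform (m : int * int) : int := m.1 ^+ 2 + m.1 * m.2 + m.2 ^+ 2.

Lemma plane_adjE (m m' : int * int) : plane_adj m m' = (hexform (m - m') == 1).
Proof.
rewrite /plane_adj; case: (m - m') => x y; rewrite !inE !xpair_eqE /hexform /=.
apply/idP/eqP; first by
  repeat case/orP => [/andP[/eqP-> /eqP->] //|]; case/andP => /eqP-> /eqP->.
move=> e1.
(* Completing the square, $4(x^2+xy+y^2) = 3y^2 + (2x+y)^2$, so a vector of norm 1 has $|y| \le 1$,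
   and likewise $|x| \le 1$. *)
have y1 : y = 0 \/ y = 1 \/ y = -1.
  have h : 3 * y ^+ 2 + (2 * x + y) ^+ 2 = 4 * (x ^+ 2 + x * y + y ^+ 2) by ring.
  have := sqr_ge0 (2 * x + y); rewrite e1 in h => sq.
  have : 3 * y ^+ 2 <= 4 by lia.
  by clear; rewrite expr2; nia.
have x1 : x = 0 \/ x = 1 \/ x = -1.
  have h : 3 * x ^+ 2 + (2 * y + x) ^+ 2 = 4 * (x ^+ 2 + x * y + y ^+ 2) by ring.
  have := sqr_ge0 (2 * y + x); rewrite e1 in h => sq.
  have : 3 * x ^+ 2 <= 4 by lia.
  by clear; rewrite expr2; nia.
by move: e1; case: x1 => [|[]] ->; case: y1 => [|[]] ->.
Qed.

Lemma hexformN m : hexform (- m) = hexform m.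
Proof. by case: m => x y; rewrite /hexform /=; ring. Qed.

Lemma plane_adj_sym (m m' : int * int) : plane_adj m m' = plane_adj m' m.
Proof. by rewrite !plane_adjE -opprB hexformN. Qed.

Lemma plane_adj_neq (m m' : int * int) : plane_adj m m' -> m != m'.
Proof. by apply: contraTneq => ->; rewrite plane_adjE subrr. Qed.

Definition plane_tri (p q r : int * int) :=
  [&& plane_adj p q, plane_adj p r & plane_adj q r].

Lemma plane_adj_addl (p d e : int * int) :
  plane_adj (p + d) (p + e) = plane_adj d e.
Proof. by rewrite !plane_adjE opprD addrACA subrr add0r. Qed.

Lemma plane_adj_add (p d : int * int) : plane_adj (p + d) p = plane_adj d 0.
Proof. by rewrite -{2}[p]addr0 plane_adj_addl. Qed.

Definition hexagon : seq (int * int) :=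
  [:: (1, 0); (0, 1); (-1, 1); (-1, 0); (0, -1); (1, -1)].

Lemma plane_adj0 (d : int * int) : plane_adj d 0 = (d \in hexagon).
Proof. by rewrite /plane_adj subr0; apply: perm_mem. Qed.

Lemma plane_adjP (p q : int * int) :
  reflect (exists2 d, d \in hexagon & p = q + d) (plane_adj p q).
Proof.
apply: (iffP idP) => [pq|[d d6 ->]]; last by rewrite plane_adj_add plane_adj0.
by exists (p - q); rewrite -?plane_adj0 -?(plane_adj_add q) addrC subrK.
Qed.

(** Every edge lies in exactly two triangles. Translating [p] to the origin reduces this to a finite
    check on the hexagon of its neighbours. *)
Lemma plane_tri_opposite (p q r s : int * int) : plane_tri p q r ->
  plane_adj s p -> plane_adj s q -> s != r -> s = p + q - r.
Proof.
have fin : all (fun d => all (fun e => all (fun f =>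
   plane_adj d e ==> plane_adj f d ==> (f != e) ==> (f == d - e))
   hexagon) hexagon) hexagon by [].
case/and3P => pq; rewrite plane_adj_sym => /plane_adjP[e e6 ->].
move: pq; rewrite plane_adj_sym => /plane_adjP[d d6 ->].
rewrite plane_adj_addl => de.
case/plane_adjP => f f6 ->; rewrite plane_adj_addl => fd.
rewrite (inj_eq (addrI _)) => fe.
move/allP/(_ _ d6)/allP/(_ _ e6)/allP/(_ _ f6): fin.
rewrite de fd fe => /eqP->.
by rewrite [p + (p + d)]addrC opprD [RHS]addrA addrK addrA.
Qed.

Lemma plane_tri_flip (p q r : int * int) : plane_tri p q r ->
  plane_tri p q (p + q - r).
Proof.
case/and3P => pq pr qr; rewrite /plane_tri pq /=.
have sub (x y : int * int) : x - (x + y - r) = r - y.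
  by rewrite opprB opprD addrCA addNKr.
rewrite /plane_adj sub [p + q]addrC sub -!/(plane_adj _ _).
by rewrite plane_adj_sym qr plane_adj_sym pr.
Qed.

Lemma plane_adj_tri (p q : int * int) : plane_adj p q ->
  exists r, plane_tri p q r.
Proof.
have fin : all (fun d => has (fun e => plane_adj d e) hexagon) hexagon by [].
rewrite plane_adj_sym => /plane_adjP[d d6 ->].
move/allP/(_ _ d6)/hasP: fin => [e e6 de]; exists (p + e).
by rewrite /plane_tri plane_adj_addl de andbT 2!(plane_adj_sym p) !plane_adj_add
  !plane_adj0 d6.
Qed.

(** The affine map sending the base triangle [(0, 0)], [(0, 1)], [(1, 0)] to [p], [q], [r]; the base
    triangle is listed in the order of the strip. *)
Definition aff (p q r m : int * int) : int * int :=
  (p.1 + m.2 * (q.1 - p.1) + m.1 * (r.1 - p.1),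
   p.2 + m.2 * (q.2 - p.2) + m.1 * (r.2 - p.2)).

Lemma aff0 p q r : aff p q r (0, 0) = p.
Proof. by case: p => x y; rewrite /aff /= !mul0r !addr0. Qed.

Lemma aff1 p q r : aff p q r (0, 1) = q.
Proof.
case: p q => x y [x' y'].
by rewrite /aff /= !mul0r !mul1r !addr0 !(addrC _ (_ - _)) !subrK.
Qed.

Lemma aff2 p q r : aff p q r (1, 0) = r.
Proof.
case: p r => x y [x' y'].
by rewrite /aff /= !mul0r !mul1r !addr0 !(addrC _ (_ - _)) !subrK.
Qed.

(** The middle coefficient is the polar bilinear form at [d] and [e]. For two sides of a triangle of
    the tiling all three coefficients are 1, and [hexform (x, y)] comes back. *)
Lemma hexform_lin (d e : int * int) (x y : int) :
  hexform (y * d.1 + x * e.1, y * d.2 + x * e.2) =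
  x ^+ 2 * hexform e + x * y * (hexform d + hexform e - hexform (d - e)) +
  y ^+ 2 * hexform d.
Proof. by case: d e => [a b] [c d]; rewrite /hexform /=; ring. Qed.

Lemma plane_tri_hexform (p q r : int * int) : plane_tri p q r ->
  [/\ hexform (q - p) = 1, hexform (r - p) = 1 & hexform (q - p - (r - p)) = 1].
Proof.
rewrite /plane_tri !plane_adjE => /and3P[pq pr /eqP qr].
have -> : q - p - (r - p) = q - r by rewrite opprB addrA subrK.
by rewrite -(opprB p q) -(opprB p r) !hexformN (eqP pq) (eqP pr).
Qed.

Lemma hexform_aff (p q r m m' : int * int) : plane_tri p q r ->
  hexform (aff p q r m - aff p q r m') = hexform (m - m').
Proof.
case/plane_tri_hexform => pq pr qr.
have -> : aff p q r m - aff p q r m' =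
    ((m - m').2 * (q - p).1 + (m - m').1 * (r - p).1,
     (m - m').2 * (q - p).2 + (m - m').1 * (r - p).2).
  by congr (_, _); rewrite /aff /=; ring.
by rewrite hexform_lin pq pr qr /hexform /=; ring.
Qed.

Lemma aff_adj (p q r m m' : int * int) : plane_tri p q r ->
  plane_adj (aff p q r m) (aff p q r m') = plane_adj m m'.
Proof. by move=> tri; rewrite !plane_adjE hexform_aff. Qed.

Lemma hexform_eq0 (m : int * int) : hexform m = 0 -> m = 0.
Proof.
case: m => x y; rewrite /hexform /= => e0.
have h : 3 * y ^+ 2 + (2 * x + y) ^+ 2 = 4 * (x ^+ 2 + x * y + y ^+ 2) by ring.
have := sqr_ge0 (2 * x + y); have := sqr_ge0 y; rewrite e0 mulr0 in h => y2 xy2.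
have /eqP : y ^+ 2 = 0 by lia.
rewrite sqrf_eq0 => /eqP y0; move: e0.
by rewrite y0 mulr0 expr0n !addr0 => /eqP; rewrite sqrf_eq0 => /eqP ->.
Qed.

Lemma aff_inj (p q r : int * int) : plane_tri p q r -> injective (aff p q r).
Proof.
move=> tri m m' e; apply/subr0_eq/hexform_eq0.
by rewrite -(hexform_aff _ _ tri) e subrr.
Qed.

Lemma aff_surj (p q r m : int * int) : plane_tri p q r ->
  exists m', aff p q r m' = m.
Proof.
case/plane_tri_hexform => pq pr qr.
pose a := (q - p).1; pose b := (q - p).2; pose c := (r - p).1; pose d := (r - p).2.
pose D := a * d - b * c.
have DD : D ^+ 2 = 1.
  (* Gram determinant of the two edge vectors: $3D^2 = 4 - 1$. Hence $D = \pm 1$ is its own inverse,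
     and Cramer's rule gives an integral preimage. *)
  have : 3 * D ^+ 2 = 4 * hexform (q - p) * hexform (r - p) -
      (hexform (q - p) + hexform (r - p) - hexform (q - p - (r - p))) ^+ 2.
    by rewrite /D /a /b /c /d /hexform /=; ring.
  by rewrite pq pr qr; lia.
exists (D * (a * (m.2 - p.2) - b * (m.1 - p.1)), D * ((m.1 - p.1) * d - (m.2 - p.2) * c)).
rewrite /aff /= -/a -/b -/c -/d [RHS]surjective_pairing; congr (_, _).
  transitivity (p.1 + D ^+ 2 * (m.1 - p.1)); last by rewrite DD; ring.
  by rewrite /D; ring.
transitivity (p.2 + D ^+ 2 * (m.2 - p.2)); last by rewrite DD; ring.
by rewrite /D; ring.
Qed.

(** The vertices of the strip between the lines of height 0 and 1, read alternately: even indices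
    lie on the wall, odd ones are apexes. *)
Definition zig (k : nat) : int * int := (k./2%:Z, (odd k)%:Z).

Lemma zig_inj : injective zig.
Proof. by move=> j k []; lia. Qed.

Lemma zig_nat_split (k : nat) : exists (i : nat) (b : bool), k = (i.*2 + b)%N.
Proof. by exists k./2, (odd k); rewrite addnC odd_double_half. Qed.

Lemma zigE (i : nat) (b : bool) : zig (i.*2 + b)%N = (i%:Z, (b : nat)%:Z).
Proof. by rewrite addnC /zig half_bit_double oddD odd_double addbF oddb. Qed.

Lemma zigS (i : nat) (b : bool) :
  zig (i.*2 + b).+1 = ((i + b)%N%:Z, (~~ b : nat)%:Z).
Proof.
case: b; rewrite ?addn0 ?addn1 /zig ?oddS ?oddD odd_double //=;
  by congr (_, _); lia.
Qed.

Lemma zigSS (k : nat) : zig k.+2 = zig k + (1, 0).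
Proof. by congr (_, _); rewrite /= ?negbK; lia. Qed.

Lemma zig_tri (k : nat) : plane_tri (zig k) (zig k.+1) (zig k.+2).
Proof.
case: (zig_nat_split k) => i [b ->]; rewrite zigSS zigS zigE.
have -> : (i%:Z, (b : nat)%:Z) + (1, 0) = (i%:Z, 0) + (1, (b : nat)%:Z).
  by congr (_, _) => /=; lia.
have -> : (i%:Z, (b : nat)%:Z) = (i%:Z, 0) + (0, (b : nat)%:Z).
  by congr (_, _) => /=; lia.
have -> : ((i + b)%N%:Z, (~~ b : nat)%:Z) = (i%:Z, 0) + ((b : nat)%:Z, (~~ b : nat)%:Z).
  by congr (_, _) => /=; lia.
by rewrite /plane_tri !plane_adj_addl; case: b.
Qed.

Lemma zig_flip (k : nat) : zig k.+1 + zig k.+2 - zig k = zig k.+3.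
Proof. by rewrite [zig k.+3]zigSS zigSS (addrCA (zig k.+1)) [LHS]addrC addKr. Qed.

(** Sending the base triangle to the end of the strip read backwards reverses the whole strip. This
    turns a chart around. *)
Lemma aff_zig_rev (n k : nat) : (k <= n.+2)%N ->
  aff (zig n.+2) (zig n.+1) (zig n) (zig k) = zig (n.+2 - k)%N.
Proof.
case: (zig_nat_split n) => i [b ->]; case: (zig_nat_split k) => j [c ->] kn.
rewrite zigSS zigS !zigE /aff /=.
(* The term [~~ b * c] is the borrow that occurs when [n] is even and [k] is odd. *)
have -> : ((i.*2 + b).+2 - (j.*2 + c) = (i.+1 - j - ~~ b * c).*2 + (b (+) c))%N.
  by case: b c kn => [] []; lia.
by rewrite zigE; congr (_, _); case: b c kn => [] []; lia.
Qed.

(* Folding the end of the strip back over its last panel moves the wall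
   through that panel, and with it the first vertices. *)
Lemma aff_zig_fold (n : nat) :
  aff (zig n) (zig n.+2) (zig n.+1) (zig n.+2) = zig 1 -> n = 0%N.
Proof.
case: (zig_nat_split n) => i [b ->].
rewrite zigSS zigS !zigE /aff /=; case: b => -[] /=; lia.
Qed.

(** * Simplicial isomorphisms of the plane and their rigidity *)

Lemma simplicial_iso_comp (U V W : choiceType) (X : set {fset U})
    (Y : set {fset V}) (Z : set {fset W}) (f : U -> V) (g : V -> W) :
  simplicial_iso X Y f -> simplicial_iso Y Z g -> simplicial_iso X Z (g \o f).
Proof.
move=> [fb fs] [gb gs]; split; first exact: set_bij_comp fb gb.
move=> s sX; rewrite fs // gs; last first.
  by move=> v /imfsetP[u us ->]; case: fb => ff _ _; apply/ff/sX.
suff -> : [fset g v | v in [fset f v | v in s]] = [fset (g \o f) v | v in s] by [].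
apply/fsetP => w; apply/imfsetP/imfsetP.
  by case=> v /imfsetP[u us ->] ->; exists u.
by case=> u us ->; exists (f u) => //; apply/imfsetP; exists u.
Qed.

Lemma plane1 (m : int * int) : plane [fset m].
Proof.
split; first by apply/fset0Pn; exists m; rewrite in_fset1.
by move=> a b /fset1P-> /fset1P->; rewrite eqxx.
Qed.

Lemma plane2 (m m' : int * int) : plane_adj m m' -> plane [fset m; m'].
Proof.
move=> mm'; split; first by apply/fset0Pn; exists m; rewrite in_fset2 eqxx.
by move=> a b /fset2P[] -> /fset2P[] ->; rewrite ?eqxx // plane_adj_sym.
Qed.

Lemma plane_imfset (h : int * int -> int * int) (s : {fset int * int}) :
  injective h -> (forall m m', plane_adj (h m) (h m') = plane_adj m m') ->
  plane s <-> plane [fset h m | m in s].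
Proof.
move=> hI hadj; split=> -[/fset0Pn[m ms] cl].
  split; first by apply/fset0Pn; exists (h m); apply/imfsetP; exists m.
  move=> _ _ /imfsetP[a /= sa ->] /imfsetP[b /= sb ->].
  by rewrite hadj (inj_eq hI); apply: cl.
split; first by case/imfsetP: ms => a /= sa _; apply/fset0Pn; exists a.
move=> a b sa sb ab; rewrite -hadj; apply: cl; rewrite ?(inj_eq hI) //.
  by apply/imfsetP; exists a.
by apply/imfsetP; exists b.
Qed.

Lemma simplicial_iso_aff (p q r : int * int) : plane_tri p q r ->
  simplicial_iso plane plane (aff p q r).
Proof.
move=> tri; split; last first.
  move=> s _; apply: plane_imfset; first exact: aff_inj.
  by move=> m m'; exact: aff_adj.
split; first by move=> m _; exact: plane1.
  by move=> m m' _ _; exact: aff_inj.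
by move=> m _; have [m' <-] := aff_surj m tri; exists m' => //; exact: plane1.
Qed.

Lemma plane_tri_flip_neq (p q r : int * int) : plane_tri p q r ->
  p + q - r != r.
Proof.
move=> tri; rewrite -{2}(aff2 p q r).
have -> : p + q - r = aff p q r (-1, 1) by congr (_, _) => /=; ring.
by rewrite (inj_eq (aff_inj tri)).
Qed.

Lemma plane_tri_addl (m p q r : int * int) :
  plane_tri (m + p) (m + q) (m + r) = plane_tri p q r.
Proof. by rewrite /plane_tri !plane_adj_addl. Qed.

Lemma plane_ind (P : int * int -> Prop) : P 0 ->
  (forall m d, P m -> d \in [:: (1, 0); (-1, 0); (0, 1); (0, -1)] -> P (m + d)) ->
  forall m, P m.
Proof.
move=> P0 Pd [x y].
have Px (n : nat) : P (n%:Z, 0) /\ P (- n%:Z, 0).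
  elim: n => [//|n [IHp IHn]]; split.
    by have /(_ isT) := Pd _ (1, 0) IHp; congr P; congr (_, _) => /=; lia.
  by have /(_ isT) := Pd _ (-1, 0) IHn; congr P; congr (_, _) => /=; lia.
have Py x' (n : nat) : P (x', 0) -> P (x', n%:Z) /\ P (x', - n%:Z).
  move=> Px'; elim: n => [//|n [IHp IHn]]; split.
    by have /(_ isT) := Pd _ (0, 1) IHp; congr P; congr (_, _) => /=; lia.
  by have /(_ isT) := Pd _ (0, -1) IHn; congr P; congr (_, _) => /=; lia.
have {}Px : P (x, 0) by case: x => n; [case: (Px n) | rewrite NegzE; case: (Px n.+1)].
by case: y => n; [case: (Py x n Px) | rewrite NegzE; case: (Py x n.+1 Px)].
Qed.

Lemma imfset2 (U V : choiceType) (f : U -> V) (m m' : U) :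
  [fset f x | x in [fset m; m']] = [fset f m; f m'].
Proof.
apply/fsetP => v; rewrite in_fset2; apply/imfsetP/orP.
  by case=> x /fset2P[] -> ->; [left | right].
by case=> /eqP->; [exists m | exists m']; rewrite //= in_fset2 eqxx ?orbT.
Qed.

Section PlaneIso.
Variables (V : choiceType) (S : set {fset V}) (f : int * int -> V).
Hypothesis f_iso : simplicial_iso plane S f.

Lemma plane_iso_inj : injective f.
Proof.
by case: f_iso => -[_ fI _] _ m m'; apply: fI; rewrite ?inE //; exact: plane1.
Qed.

Lemma plane_iso_vertex m : S [fset f m].
Proof. by case: f_iso => -[ff _ _] _; apply: ff; exact: plane1. Qed.

Lemma plane_iso_surj v : S [fset v] -> exists m, v = f m.
Proof. by case: f_iso => -[_ _ fS] _ /fS[m _ <-]; exists m. Qed.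

Lemma plane_iso_simplex s : plane s <-> S [fset f m | m in s].
Proof. by case: f_iso => _; apply=> m _; exact: plane1. Qed.

Lemma plane_iso_edge m m' :
  plane_adj m m' <-> f m != f m' /\ S [fset f m; f m'].
Proof.
rewrite (inj_eq plane_iso_inj) -imfset2; split.
  by move=> mm'; split; [exact: plane_adj_neq | exact/plane_iso_simplex/plane2].
by case=> neq /plane_iso_simplex[_]; apply=> //; rewrite in_fset2 eqxx ?orbT.
Qed.

End PlaneIso.

(** Agreement on a triangle passes to the vertex across each of its edges: an edge has only two
    triangles, and injectivity excludes the old one. Moving from triangle to triangle reaches the
    whole plane. *)
Lemma plane_iso_rigid (V : choiceType) (S : set {fset V})
    (f g : int * int -> V) :
  simplicial_iso plane S f -> simplicial_iso plane S g ->
  (forall k, (k < 3)%N -> f (zig k) = g (zig k)) -> f =1 g.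
Proof.
move=> fI gI fg.
have flip p q r : plane_tri p q r -> f p = g p -> f q = g q -> f r = g r ->
    f (p + q - r) = g (p + q - r).
  move=> tri fp fq fr.
  have [m e] := plane_iso_surj gI (plane_iso_vertex fI (p + q - r)).
  have adj x : f x = g x -> plane_adj x (p + q - r) -> plane_adj x m.
    by move=> fx /(plane_iso_edge fI); rewrite e fx => /(plane_iso_edge gI).
  case/and3P: (plane_tri_flip tri) => _ ps qs.
  rewrite e; congr g; apply: (plane_tri_opposite tri).
  - by rewrite plane_adj_sym; exact: adj.
  - by rewrite plane_adj_sym; exact: adj.
  apply/eqP => mr; move: e; rewrite mr -fr => /(plane_iso_inj fI) e.
  by have := plane_tri_flip_neq tri; rewrite e eqxx.
pose P m d := f (m + d) = g (m + d).
have {}flip m p q r s : plane_tri p q r -> P m p -> P m q -> P m r ->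
    s == p + q - r -> P m s.
  move=> tri Pp Pq Pr /eqP ->; rewrite /P.
  have -> : m + (p + q - r) = m + p + (m + q) - (m + r).
    by rewrite opprD [m + p + _]addrACA [RHS]addrACA addrK.
  by apply: flip; rewrite ?plane_tri_addl.
(* The induction carries the upright triangle based at [m]; seven flips starting from it cover its
   four translates. *)
suff all3 m : [/\ P m (0, 0), P m (0, 1) & P m (1, 0)].
  by move=> m; case: (all3 m); rewrite /P (_ : (0, 0) = 0) // addr0.
elim/plane_ind: m => [|m d [P0 P1 P2] d4].
  by rewrite /P !add0r; split; [exact: (fg 0%N) | exact: (fg 1%N) | exact: (fg 2)].
have P11 : P m (1, 1) by exact: (flip m (0, 1) (1, 0) (0, 0)).
have P20 : P m (2, 0) by exact: (flip m (1, 0) (1, 1) (0, 1)).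
have P02 : P m (0, 2) by exact: (flip m (0, 1) (1, 1) (1, 0)).
have Pm1 : P m (-1, 1) by exact: (flip m (0, 0) (0, 1) (1, 0)).
have Pm0 : P m (-1, 0) by exact: (flip m (0, 0) (-1, 1) (0, 1)).
have P1m : P m (1, -1) by exact: (flip m (0, 0) (1, 0) (0, 1)).
have P0m : P m (0, -1) by exact: (flip m (0, 0) (1, -1) (1, 0)).
move: d4; rewrite /P -!addrA !inE.
by repeat case/orP => [/eqP-> //|]; move/eqP->.
Qed.

(** * Charts and retractions *)

Section Charts.
Variables (V : choiceType) (X : set {fset V}) (A : set (set {fset V})).
Hypotheses (X_vertex : forall v, X [fset v])
  (A_system : apartment_system X A).

Definition triangle (u v w : V) : Prop :=
  [/\ adjacent X u v, adjacent X u w & adjacent X v w].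

Definition chart (f : int * int -> V) : Prop :=
  exists2 S, A S & simplicial_iso plane S f.

Lemma adjacent_sym u v : adjacent X u v -> adjacent X v u.
Proof. by case=> uv Xuv; split; rewrite 1?eq_sym 1?fsetUC. Qed.

Lemma apartment_vertex S s v : A S -> S s -> v \in s -> S [fset v].
Proof.
move=> AS Ss vs; case: A_system => /(_ _ AS)[_ [_ sub] _] _ _; apply: sub Ss _ _.
  by rewrite fsub1set.
by apply/fset0Pn; exists v; rewrite in_fset1.
Qed.

(** The edge lies in some apartment [S'], and an isomorphism from [S] to [S'] fixing [u] and [v]
    carries it back to [S]. *)
Lemma apartment_edge S u v : A S -> S [fset u] -> S [fset v] ->
  X [fset u; v] -> S [fset u; v].
Proof.
move=> AS Su Sv Xuv; case: A_system => _ B1 B2.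
have [S' [AS' S'uv _]] := B1 _ _ Xuv Xuv.
have S'u : S' [fset u] by apply: apartment_vertex S'uv _; rewrite // in_fset2 eqxx.
have S'v : S' [fset v] by apply: apartment_vertex S'uv _; rewrite // in_fset2 eqxx orbT.
have [h [[_ hs] hid]] := B2 _ _ AS AS' _ _ Su Sv S'u S'v.
apply/hs; first by move=> w /fset2P[] ->.
by rewrite imfset2 !hid // in_fset2 eqxx ?orbT.
Qed.

(** Cliques of the plane are simplices, so pulling a clique back through a chart shows that it is a
    simplex of the apartment. *)
Lemma apartment_full S s : A S -> s != fset0 ->
  (forall v, v \in s -> S [fset v]) ->
  (forall u v, u \in s -> v \in s -> u != v -> adjacent X u v) -> S s.
Proof.
move=> AS s0 sS sadj; case: A_system => /(_ _ AS)[_ _ [f fI]] _ _.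
(* The default [(0, 0)] is taken only outside the image of [f]. *)
pose g v := xget (0, 0) [set m | f m = v]%classic.
have fg v : v \in s -> f (g v) = v.
  move=> /sS/(plane_iso_surj fI)[m e].
  exact: (@xgetPex _ (0, 0) [set x | f x = v]%classic (ex_intro _ m (esym e))).
have <- : [fset f m | m in [fset g v | v in s]] = s.
  apply/fsetP => v; apply/imfsetP/idP => [[_ /imfsetP[w /= ws ->] ->]|vs].
    by rewrite fg.
  by exists (g v); rewrite ?fg //; apply/imfsetP; exists v.
apply/(plane_iso_simplex fI); split.
  by case/fset0Pn: s0 => v vs; apply/fset0Pn; exists (g v); apply/imfsetP; exists v.
move=> _ _ /imfsetP[u /= us ->] /imfsetP[v /= vs ->] uv.
have {}uv : u != v by apply: contraNneq uv => ->.
apply/(plane_iso_edge fI); rewrite !fg //; split=> //.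
by have [_] := sadj u v us vs uv; apply: apartment_edge => //; exact: sS.
Qed.

Lemma chart_adj f m m' : chart f -> plane_adj m m' <-> adjacent X (f m) (f m').
Proof.
case=> S AS fI; split=> [/(plane_iso_edge fI)[neq Smm']|[neq Xmm']].
  by split=> //; case: A_system => /(_ _ AS)[sub _ _] _ _; exact: sub.
apply/(plane_iso_edge fI); split=> //.
by apply: apartment_edge => //; exact: (plane_iso_vertex fI).
Qed.

Lemma chart_aff f p q r : chart f -> plane_tri p q r -> chart (f \o aff p q r).
Proof.
move=> [S AS fI] tri; exists S => //.
exact: simplicial_iso_comp (simplicial_iso_aff tri) fI.
Qed.

Lemma chart_simplices a b : X a -> X b ->
  exists2 f, chart f & forall v, v \in a `|` b -> exists m, v = f m.
Proof.
move=> Xa Xb; case: A_system => B0 B1 _.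
have [S [AS Sa Sb]] := B1 _ _ Xa Xb; have [_ _ [f fI]] := B0 _ AS.
exists f; first by exists S.
move=> v /fsetUP[] vs; apply: (plane_iso_surj fI).
  exact: apartment_vertex Sa vs.
exact: apartment_vertex Sb vs.
Qed.

(** An edge and the third vertex lie in a common apartment, which is a full subcomplex. *)
Lemma triangle_simplex u v w : triangle u v w -> X [fset u; v; w].
Proof.
case=> uv uw vw; case: A_system => B0 B1 _; case: (uv) => _ Xuv.
have [S [AS Suv Sw]] := B1 _ _ Xuv (X_vertex w); have [sub _ _] := B0 _ AS.
apply: sub; apply: apartment_full => //.
- by apply/fset0Pn; exists w; rewrite !inE eqxx orbT.
- move=> x /fsetUP[xuv|/fset1P->//]; exact: apartment_vertex Suv xuv.
move=> x y; rewrite !inE => /orP[/orP[]|] /eqP-> /orP[/orP[]|] /eqP->;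
  rewrite ?eqxx // => _; by [|exact: adjacent_sym].
Qed.

(* Well-definedness of the retraction onto an apartment centred at a chamber. *)
Lemma chart_retraction f g m m' : chart f -> chart g ->
  (forall k, (k < 3)%N -> f (zig k) = g (zig k)) -> f m = g m' -> m = m'.
Proof.
move=> cf cg fg e; case: (cf) (cg) => [S AS fI] [S' AS' gI].
case: A_system => _ _ B2.
have tri : triangle (f (zig 0)) (f (zig 1)) (f (zig 2)).
  by case/and3P: (zig_tri 0) => *; split; apply/chart_adj.
pose c := [fset f (zig 0); f (zig 1); f (zig 2)].
have c3 v : v \in c -> exists2 k, (k < 3)%N & v = f (zig k).
  by rewrite !inE => /orP[/orP[]|] /eqP->; [exists 0%N | exists 1%N | exists 2].
have c0 : c != fset0 by apply/fset0Pn; exists (f (zig 0)); rewrite !inE eqxx.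
have cadj u v : u \in c -> v \in c -> u != v -> adjacent X u v.
  case: tri => t01 t02 t12.
  rewrite !inE => /orP[/orP[]|] /eqP-> /orP[/orP[]|] /eqP->;
  rewrite ?eqxx // => _; by [|exact: adjacent_sym].
have Sc : S c.
  by apply: apartment_full => // v /c3[k _ ->]; exact: (plane_iso_vertex fI).
have S'c : S' c.
  by apply: apartment_full => // v /c3[k /fg-> ->]; exact: (plane_iso_vertex gI).
have Sm : S [fset f m] by exact: (plane_iso_vertex fI).
have S'm : S' [fset f m] by rewrite e; exact: (plane_iso_vertex gI).
have [h [hI hid]] := B2 _ _ AS AS' _ _ Sc Sm S'c S'm.
(* Both maps are isomorphisms of the plane onto [S'] and agree on the central triangle, so rigidity
   applies. *)
have hf : h \o f =1 g.
  apply: plane_iso_rigid (simplicial_iso_comp fI hI) gI _ => k k3 /=.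
  rewrite -fg // hid // inE; apply/orP; left.
  by rewrite !inE; case: k k3 => [|[|[|]]] // _; rewrite eqxx ?orbT.
apply: (plane_iso_inj gI); rewrite -e -hf /= hid // !inE eqxx orbT //.
Qed.

(** * Straight strips *)

Lemma triangle_rev u v w : triangle u v w -> triangle w v u.
Proof. by case=> uv uw vw; split; exact: adjacent_sym. Qed.

Lemma chart_triangle f p q r : chart f -> plane_tri p q r ->
  triangle (f p) (f q) (f r).
Proof. by move=> cf /and3P[pq pr qr]; split; apply/chart_adj. Qed.

(** An apartment through the triangle and [b] is given coordinates in which the triangle is the base
    triangle. *)
Lemma chart_based (v : nat -> V) b : triangle (v 0%N) (v 1%N) (v 2) -> X b ->
  exists f, [/\ chart f, forall k, (k < 3)%N -> f (zig k) = v k &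
    forall x, x \in b -> exists m, x = f m].
Proof.
move=> tri Xb; have [f cf im] := chart_simplices (triangle_simplex tri) Xb.
have [|p e0] := im (v 0%N); first by rewrite !inE eqxx.
have [|q e1] := im (v 1%N); first by rewrite !inE eqxx orbT.
have [|r e2] := im (v 2); first by rewrite !inE eqxx !orbT.
have pqr : plane_tri p q r.
  move: tri; rewrite e0 e1 e2 => -[pq pr qr].
  by apply/and3P; split; apply/(chart_adj _ _ cf).
exists (f \o aff p q r); split; first exact: chart_aff.
  by case=> [|[|[|]]] //= _; rewrite ?e0 ?e1 ?e2 ?aff0 ?aff1 ?aff2.
move=> x xb; have [|m ->] := im x; first by rewrite inE xb orbT.
by have [m' <-] := aff_surj m pqr; exists m'.
Qed.

(** The second condition says that the gallery does not fold back over the panel [v k.+1],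
    [v k.+2]. *)
Definition zigzag (v : nat -> V) (n : nat) : Prop :=
  (forall k, (k.+2 <= n)%N -> triangle (v k) (v k.+1) (v k.+2)) /\
  (forall k, (k.+3 <= n)%N -> v k != v k.+3).

Lemma zigzag_rev v n : zigzag v n -> zigzag (fun k => v (n - k)%N) n.
Proof.
case=> tri stut; split=> k kn.
  have := tri (n - k.+2)%N.
  have -> : ((n - k.+2).+2 = n - k)%N by lia.
  have -> : ((n - k.+2).+1 = n - k.+1)%N by lia.
  by move=> h; apply/triangle_rev/h; lia.
rewrite eq_sym; have := stut (n - k.+3)%N.
have -> : (n - k.+3).+3 = (n - k)%N by lia.
by apply; lia.
Qed.

Lemma zigzag_sub v n m : (m <= n)%N -> zigzag v n -> zigzag v m.
Proof.
by move=> mn [tri stut]; split=> k km; [apply: tri | apply: stut]; exact: leq_trans mn.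
Qed.

(* The position of a vertex relative to the first triangle is its image under
   the retraction centred there. If the last vertex were folded back, the
   position of v 1 relative to the last triangle would contradict the induction
   hypothesis for the reversed sequence. *)
Lemma zigzag_position v n k : zigzag v n.+2 -> (k <= n.+2)%N ->
  exists f, [/\ chart f, forall i, (i < 3)%N -> f (zig i) = v i & f (zig k) = v k].
Proof.
elim: n v k => [|n IHn] v k vz.
  rewrite -ltnS => k3; case: (vz) => tri _.
  have [f [cf st _]] := chart_based (tri 0%N isT) (X_vertex (v 0%N)).
  by exists f; split=> //; exact: st.
have vz' := zigzag_sub (leqnSn _) vz.
rewrite leq_eqVlt ltnS => /orP[/eqP->|]; last exact: IHn.
case: (vz) => tri stut.
have tri_n : triangle (v n.+1) (v n.+2) (v n.+3) by exact: tri.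
have [f [cf st im]] := chart_based (tri 0%N isT) (triangle_simplex tri_n).
(* An earlier vertex that happens to lie in this chart sits at its [zig] position, by the induction
   hypothesis and the uniqueness of positions. *)
have pos j m : (j <= n.+2)%N -> v j = f m -> f (zig j) = v j.
  move=> jn e; have [g [cg gst ge]] := IHn v j vz' jn.
  rewrite e; congr f; apply/esym/(chart_retraction cf cg); last by rewrite -e ge.
  by move=> i i3; rewrite st // gst.
exists f; split=> //.
have [|m1 e1] := im (v n.+1); first by rewrite !inE eqxx.
have [|m2 e2] := im (v n.+2); first by rewrite !inE eqxx orbT.
have [|m e] := im (v n.+3); first by rewrite !inE eqxx !orbT.
have {e1}e1 := pos _ _ (leqnSn _) e1; have {e2}e2 := pos _ _ (leqnn _) e2.
have zt : plane_tri (zig n.+1) (zig n.+2) (zig n).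
  by case/and3P: (zig_tri n) => *; apply/and3P;
    rewrite ![plane_adj _ (zig n)]plane_adj_sym.
(* Only two vertices of the chart complete the last panel: [zig n], the folded case to be excluded,
   and [zig n.+3]. *)
have [mn|mn] := eqVneq m (zig n); last first.
  rewrite e; congr f; rewrite -zig_flip; apply/esym/plane_tri_opposite => //.
    by rewrite plane_adj_sym; apply/(chart_adj _ _ cf); rewrite e1 -e; case: tri_n.
  by rewrite plane_adj_sym; apply/(chart_adj _ _ cf); rewrite e2 -e; case: tri_n.
have [n0|n0] := posnP n.
  by have := stut n (leqnn _); rewrite e mn n0 st // eqxx.
(* In the reversed sequence [v 1] has index [n.+2], so dropping [v 0] brings it within reach of the
   induction hypothesis. *)
have [g [cg gst ge]] := IHn _ n.+2 (zigzag_sub (leqnSn _) (zigzag_rev vz)) (leqnn _).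
have zt' : plane_tri (zig n) (zig n.+2) (zig n.+1).
  by case/and3P: (zig_tri n) => *; apply/and3P;
    rewrite [plane_adj (zig n.+2) _]plane_adj_sym.
have [m0 am0] := aff_surj (zig 1) zt'.
have := chart_retraction (m := m0) (m' := zig n.+2) (chart_aff cf zt') cg.
rewrite ge /= am0 st // (_ : (n.+3 - n.+2 = 1)%N); last by lia.
move=> ret; suff m0z : m0 = zig n.+2.
  by move: am0; rewrite m0z => /aff_zig_fold n00; rewrite n00 in n0.
apply: ret => //; case=> [|[|[|]]] //= _; rewrite gst // ?aff0 ?aff1 ?aff2.
- by rewrite subn0 e mn.
- by rewrite e2 subSS subn0.
- by rewrite e1 !subSS subn0.
Qed.

(* Straight galleries are convex: a chart that contains the two end triangles
   contains the whole sequence. If it missed v k.+3, then v k.+1, v k.+2 could be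
   continued backwards by the vertex of the chart, and that vertex would have
   two positions relative to the last triangle. *)
Lemma zigzag_chart v n : zigzag v n.+2 ->
  exists2 f, chart f & forall k, (k <= n.+2)%N -> f (zig k) = v k.
Proof.
move=> vz; case: (vz) => tri stut.
have tri_n : triangle (v n) (v n.+1) (v n.+2) by exact: tri.
have [f [cf st im]] := chart_based (tri 0%N isT) (triangle_simplex tri_n).
exists f => //.
have pos j m : (j <= n.+2)%N -> v j = f m -> f (zig j) = v j.
  move=> jn e; have [g [cg gst ge]] := zigzag_position vz jn.
  rewrite e; congr f; apply/esym/(chart_retraction cf cg); last by rewrite -e ge.
  by move=> i i3; rewrite st // gst.
have [|m0 e0] := im (v n); first by rewrite !inE eqxx.
have [|m1 e1] := im (v n.+1); first by rewrite !inE eqxx orbT.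
have [|m2 e2] := im (v n.+2); first by rewrite !inE eqxx !orbT.
have {e0}e0 : f (zig n) = v n by apply: pos e0; rewrite -addn2 leq_addr.
have {e1}e1 := pos _ _ (leqnSn _) e1; have {e2}e2 := pos _ _ (leqnn _) e2.
elim/ltn_ind => -[|[|[|k]]] IH kn; try exact: st.
apply/eqP/negPn/negP => neq.
have [j jk] : exists j, (j.+3 + k = n.+2)%N by exists (n.+2 - k.+3)%N; lia.
(* The sequence read backwards from [v n.+2] to [v k.+1], then continued by the vertex of the chart;
   [neq] ensures that it does not fold back at its last panel. *)
pose w i := if (i < j.+3)%N then v (n.+2 - i)%N else f (zig k.+3).
have w_lt i : (i < j.+3)%N -> w i = v (n.+2 - i)%N by rewrite /w => ->.
have w_eq : w j.+3 = f (zig k.+3) by rewrite /w ltnn.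
have wz : zigzag w j.+3.
  clearbody w; have [rtri rstut] := zigzag_rev vz; split=> i.
    rewrite leq_eqVlt !ltnS => /predU1P[[->]|ij]; last first.
      by rewrite !w_lt; [apply: rtri; lia | lia..].
    rewrite w_eq !w_lt //; have -> : (n.+2 - j.+1 = k.+2)%N by lia.
    have -> : (n.+2 - j.+2 = k.+1)%N by lia.
    rewrite -!IH; [|lia..]; apply: chart_triangle => //.
    case/and3P: (zig_tri k.+1) => h1 h2 h3; apply/and3P; split=> //.
    by rewrite plane_adj_sym.
  rewrite leq_eqVlt !ltnS => /predU1P[[->]|ij]; last first.
    by rewrite !w_lt; [apply: rstut; lia | lia..].
  rewrite w_eq w_lt; last by lia.
  have -> : (n.+2 - j = k.+3)%N by lia.
  by rewrite eq_sym.
have [g [cg gst ge]] := zigzag_position wz (leqnn _).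
have zt : plane_tri (zig n.+2) (zig n.+1) (zig n).
  by case/and3P: (zig_tri n) => *; apply/and3P;
    rewrite ![plane_adj (zig n.+2) _]plane_adj_sym
      [plane_adj (zig n.+1) (zig n)]plane_adj_sym.
(* The vertex [f (zig k.+3)] has position [zig j] in the reversed chart, but position [zig j.+3] as
   the end of [w]. *)
have := chart_retraction (m := zig j) (m' := zig j.+3) (chart_aff cf zt) cg.
rewrite ge /= aff_zig_rev; last by lia.
rewrite w_eq (_ : (n.+2 - j = k.+3)%N); last by lia.
move=> ret; suff /zig_inj : zig j = zig j.+3 by lia.
apply: ret => // i i3; rewrite gst // w_lt; last exact: leq_trans i3 _.
by case: i i3 => [|[|[|]]] //= _;
  rewrite ?aff0 ?aff1 ?aff2 ?e0 ?e1 ?e2 ?subn0 ?subSS ?subn0.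
Qed.

(** * Links *)

(* The link of a vertex contains no circuit of length 4. *)
Lemma common_neighbour_unique o u v w w' : u != v ->
  triangle o u w -> triangle o v w -> triangle o u w' -> triangle o v w' -> w = w'.
Proof.
move=> uv ouw ovw ouw' ovw'; apply/eqP/negPn/negP => ww'.
pose x k := nth o [:: o; u; w] k.
have [f [cf st im]] := chart_based (v := x) ouw (triangle_simplex ovw').
have e0 : o = f 0 by exact: esym (st 0%N isT).
have eu : u = f (0, 1) by exact: esym (st 1%N isT).
have ew : w = f (1, 0) by exact: esym (st 2 isT).
have [|m em] := im v; first by rewrite !inE eqxx orbT.
have [|m' em'] := im w'; first by rewrite !inE eqxx !orbT.
have adj a b : adjacent X (f a) (f b) -> plane_adj a b by move/(chart_adj _ _ cf).
(* With [o], [u], [w] as base triangle, [v] and [w'] are forced to [(1, -1)] and [(-1, 1)], opposite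
   vertices of the hexagon around [o], which are not adjacent. *)
have mE : m = 0 + (1, 0) - (0, 1).
  apply: plane_tri_opposite => //.
  - by rewrite plane_adj_sym; apply: adj; rewrite -e0 -em; case: ovw.
  - by apply: adj; rewrite -ew -em; case: ovw.
  by apply: contraNneq uv => m01; rewrite eu em m01.
have m'E : m' = 0 + (0, 1) - (1, 0).
  apply: plane_tri_opposite => //.
  - by rewrite plane_adj_sym; apply: adj; rewrite -e0 -em'; case: ovw'.
  - by rewrite plane_adj_sym; apply: adj; rewrite -eu -em'; case: ouw'.
  by apply: contraNneq ww' => m10; rewrite ew em' m10.
have : plane_adj m m' by apply: adj; rewrite -em -em'; case: ovw'.
by rewrite mE m'E.
Qed.

Variable tau : V -> 'Z_3.
Hypothesis tau_type : type_function X tau.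

Lemma adjacent_triangle u v : adjacent X u v -> exists w, triangle u v w.
Proof.
move=> uv; case: (uv) => _ Xuv.
have [f cf im] := chart_simplices Xuv Xuv.
have [|p ep] := im u; first by rewrite !inE eqxx.
have [|q eq] := im v; first by rewrite !inE eqxx orbT.
have /plane_adj_tri[r pqr] : plane_adj p q by apply/(chart_adj _ _ cf); rewrite -ep -eq.
by exists (f r); rewrite ep eq; exact: chart_triangle.
Qed.

Lemma adjacent_type u v : adjacent X u v -> tau u != tau v.
Proof.
move=> uv; have [w tri] := adjacent_triangle uv; apply/eqP => tuv.
have ch : chamber X [fset u; v; w].
  split; first exact: triangle_simplex.
  case: tri => -[uv' _] [uw _] [vw _].
  by rewrite -fsetUA cardfsU1 cardfs2 !inE negb_or uv' uw vw.
have [x [_ xu]] := tau_type ch (tau u); case: (uv) => /eqP[].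
rewrite -(xu u); last by rewrite !inE eqxx.
by rewrite -(xu v) // !inE eqxx orbT.
Qed.

Lemma Z3_third (x a b c : 'Z_3) :
  x != a -> x != b -> x != c -> a != b -> b != c -> a = c.
Proof.
move=> xa xb xc ab bc; apply/eqP; move: xa xb xc ab bc.
by case: x a b c => [[|[|[|?]]] ?] [[|[|[|?]]] ?] [[|[|[|?]]] ?] [[|[|[|?]]] ?].
Qed.

(** In an apartment through both edges the link of [o] is a hexagon with alternating types, so
    distinct vertices of equal type are at distance 2 in it. *)
Lemma common_neighbour o u v : u != v -> tau u = tau v ->
  adjacent X o u -> adjacent X o v -> exists w, triangle o u w /\ triangle o v w.
Proof.
move=> uv tuv ou ov; case: (ou) (ov) => _ Xou [_ Xov].
have [f' cf' im'] := chart_simplices Xou Xov.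
have [|p ep] := im' o; first by rewrite !inE eqxx.
have [|q eq] := im' u; first by rewrite !inE eqxx orbT.
have /plane_adj_tri[r pqr] : plane_adj p q by apply/(chart_adj _ _ cf'); rewrite -ep -eq.
pose f := f' \o aff p q r.
have cf : chart f by exact: chart_aff.
have e0 : o = f (0, 0) by rewrite /f /= aff0.
have eu : u = f (0, 1) by rewrite /f /= aff1.
have [d ev] : exists d, v = f d.
  have [|m ->] := im' v; first by rewrite !inE eqxx !orbT.
  by have [m' <-] := aff_surj m pqr; exists m'.
have T a b : plane_adj a b -> tau (f a) != tau (f b).
  by move=> ab; apply/adjacent_type/chart_adj.
have := tuv; have : plane_adj d (0, 0).
  by rewrite plane_adj_sym; apply/(chart_adj _ _ cf); rewrite -ev -e0.
rewrite plane_adj0 ev eu e0 !inE.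
have tri w : plane_tri (0, 0) (0, 1) w -> plane_tri (0, 0) d w ->
    exists w, triangle (f (0, 0)) (f (0, 1)) w /\ triangle (f (0, 0)) (f d) w.
  by move=> t1 t2; exists (f w); split; exact: chart_triangle.
case/orP => [/eqP d1|]; first by move/eqP; rewrite d1 (negbTE (T _ _ _)).
case/orP => [/eqP d1|]; first by move: uv; rewrite ev eu d1 eqxx.
case/orP => [/eqP d1|]; first by move/eqP; rewrite d1 (negbTE (T _ _ _)).
case/orP => [/eqP d1 _|]; first by apply: (tri (-1, 1)); rewrite ?d1.
case/orP => [/eqP d1|/eqP d1 _]; last by apply: (tri (1, 0)); rewrite ?d1.
(* Here [d] is the antipode of [u] in the hexagon, and its type is that of [(1, 0)], a neighbour of
   [u]. *)
have -> : tau (f d) = tau (f (1, 0)).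
  by rewrite d1; apply: (@Z3_third (tau (f (0, 0))) _ (tau (f (1, -1)))); exact: T.
by move/eqP; rewrite (negbTE (T _ _ _)).
Qed.

End Charts.

(** * Walks in a labelled projective plane *)

(** Double counting of the steps inside [S]: at least [D] leave each element and all of them stay in
    [S], where each element receives at most [D]. A step entering from outside would leave [v0] with
    fewer than [D]. *)
Lemma forward_closed_backward_closed (W : finType) (step : rel W) (S : {set W})
    (D : nat) :
  (forall u v, u \in S -> step u v -> v \in S) ->
  (forall u, u \in S -> (D <= #|[set v | step u v]|)%N) ->
  (forall v, v \in S -> (#|[set u | step u v]| <= D)%N) ->
  forall u v, v \in S -> step u v -> u \in S.
Proof.
move=> fwd outD inD u0 v0 v0S step0; apply/negPn/negP => u0S.
have : (\sum_(u in S) D <= \sum_(v in S) #|[set u in S | step u v]|)%N.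
  apply: (@leq_trans (\sum_(u in S) #|[set v | step u v]|)); first exact: leq_sum.
  under eq_bigr do rewrite -sum1dep_card.
  rewrite (exchange_big_dep (mem S)) /=; last exact: fwd.
  by apply: leq_sum => v _; rewrite sum1dep_card.
rewrite leqNgt => /negP[].
rewrite (bigD1 v0) //= [X in (_ < X)%N](bigD1 v0) //= -addSn.
have lev v : v \in S -> (#|[set u in S | step u v]| <= D)%N.
  move=> /inD; apply: leq_trans; apply: subset_leq_card.
  by apply/fintype.subsetP => u; rewrite !inE => /andP[].
apply: leq_add; last by apply: leq_sum => v /andP[vS _]; exact: lev.
apply: leq_trans (inD _ v0S); apply: proper_card; apply/properP; split.
  by apply/fintype.subsetP => u; rewrite !inE => /andP[].
by exists u0; rewrite !inE // (negbTE u0S).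
Qed.

(** Projection from [p]: joining the points of [c] to [p] is injective because [p] is off [c]. *)
Lemma card_range_le_pencil (K : finType) (inc : rel K) (p c : K) :
  (forall a b, a != b -> exists c, inc a c && inc b c) ->
  (forall a b c c', a != b -> inc a c -> inc b c -> inc a c' -> inc b c' -> c = c') ->
  ~~ inc p c -> (#|[set a | inc a c]| <= #|[set d | inc p d]|)%N.
Proof.
move=> join join_uniq pc.
(* The default is never reached for a point of [c], which differs from [p] and so has a join with
   it. *)
pose line a := odflt p [pick d | inc p d && inc a d].
have lineP a : a \in [set a | inc a c] -> inc p (line a) /\ inc a (line a).
  rewrite inE => ac; rewrite /line; case: pickP => [d /andP[]//|no].
  have [|d pad] := join p a; last by rewrite no in pad.
  by apply: contraNneq pc => ->.
rewrite -(card_in_imset (f := line)).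
  apply: subset_leq_card; apply/fintype.subsetP => _ /imsetP[a /lineP[pa _] ->].
  by rewrite inE.
move=> a b aS bS eab; apply/eqP/negPn/negP => ab.
have [pa aa] := lineP _ aS; have [_ bb] := lineP _ bS.
rewrite !inE in aS bS; move: pc; rewrite (join_uniq a b c (line a)) ?pa //.
by rewrite eab.
Qed.

(** * The projective plane of labels *)

Section Labels.
Variables (K : finType) (lab : K -> K -> K -> bool).

Definition incident (a c : K) : bool := [exists x, lab a x c].

Hypotheses (lab_cycle : forall x y z, lab x y z -> lab y z x)
  (lab_uniq : forall a c x y, lab a x c -> lab a y c -> x = y)
  (join : forall a b, a != b -> exists c, incident a c && incident b c)
  (meet : forall c d, c != d -> exists a, incident a c && incident a d)
  (join_uniq : forall a b c d, a != b ->
    incident a c -> incident b c -> incident a d -> incident b d -> c = d)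
  (thick_line : forall c x y, exists z, [&& incident z c, z != x & z != y])
  (thick_point : forall a c d, exists e, [&& incident a e, e != c & e != d]).

Lemma meet_uniq c d a b : c != d ->
  incident a c -> incident a d -> incident b c -> incident b d -> a = b.
Proof.
move=> cd ac ad bc bd; apply/eqP/negPn/negP => ab.
by case/eqP: cd; exact: join_uniq ab ac bc ad bd.
Qed.

(** For distinct lines, away from their meet choose [x] on [c] and [y] on [d]; a third point of the
    line [xy] is off both. If the lines coincide, a second line is chosen first. *)
Lemma point_off_lines c d : exists a, ~~ incident a c && ~~ incident a d.
Proof.
wlog cd : d / c != d.
  move=> H; have [cd|/H//] := eqVneq c d; rewrite -cd.
  have [x /andP[xc _]] := thick_line c c c.
  have [e /and3P[_ ec _]] := thick_point x c c.
  by have [|a /andP[ac _]] := H e; [rewrite eq_sym | exists a; rewrite ac].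
have [m /andP[mc md]] := meet cd.
have [x /and3P[xc xm _]] := thick_line c m m.
have [y /and3P[yd ym _]] := thick_line d m m.
have xd : ~~ incident x d by apply: contraNN xm => xd; rewrite (meet_uniq cd xc xd mc md).
have yc : ~~ incident y c by apply: contraNN ym => yc; rewrite (meet_uniq cd yc yd mc md).
have xy : x != y by apply: contraNneq xd => ->.
have [e /andP[xe ye]] := join xy.
have [z /and3P[ze zx zy]] := thick_line e x y.
exists z; apply/andP; split.
  by apply: contraNN yc => zc; rewrite (join_uniq zx zc xc ze xe).
by apply: contraNN xd => zd; rewrite (join_uniq zy zd yd ze ye).
Qed.

Lemma line_off_point p : exists c, ~~ incident p c.
Proof.
have [c /and3P[pc _ _]] := thick_point p p p.
have [x /and3P[xc xp _]] := thick_line c p p.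
have [d /and3P[xd dc _]] := thick_point x c c.
exists d; apply: contraNN dc => pd.
by rewrite (join_uniq xp xc pc xd pd).
Qed.

(** Three perspectivities: from the points of [c] to the lines through [q], from these to the points
    of [d], and from these to the lines through [p]. *)
Lemma card_range_le_pencil_all c p :
  (#|[set a | incident a c]| <= #|[set d | incident p d]|)%N.
Proof.
have [d pd] := line_off_point p.
have [q /andP[qc qd]] := point_off_lines c d.
apply: leq_trans (card_range_le_pencil join join_uniq qc) _.
apply: leq_trans (_ : #|[set a | incident a d]| <= _)%N; last first.
  exact: card_range_le_pencil join join_uniq pd.
exact: (@card_range_le_pencil _ (fun e a => incident a e) d q meet meet_uniq qd).
Qed.

Definition step (s t : K * K * K) : bool :=
  [&& lab t.1.1 t.1.2 t.2, incident s.1.2 t.2, t.2 != s.1.1 & t.1.1 != s.1.2].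

Definition labelling (s : K * K * K) : bool := lab s.1.1 s.1.2 s.2.

Lemma labP a x c : lab a x c -> [/\ incident a c, incident x a & incident c x].
Proof.
move=> h; have h' := lab_cycle h; have h'' := lab_cycle h'.
by split; apply/existsP; [exists x | exists c | exists a].
Qed.

Lemma lab_middle m a : incident m a -> exists c, lab a m c.
Proof. by case/existsP => c /lab_cycle/lab_cycle; exists c. Qed.

(** The point [m] lies on the line [a], so [a'] differs from [m], and the join [c'] of the two is
    not [a]. *)
Lemma step_outside_line a m c a' : labelling (a, m, c) -> ~~ incident a' a ->
  exists m' c', step (a, m, c) (a', m', c').
Proof.
case/labP => ac ma cm a'a.
have a'm : a' != m by apply: contraNneq a'a => ->.
have [c' /andP[a'c' mc']] := join a'm; case/existsP: (a'c') => m' lab'.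
exists m', c'; rewrite /step /= lab' mc' a'm andbT /=.
by apply: contraNneq a'a => <-.
Qed.

Lemma out_degree s : labelling s ->
  (#|[set a | ~~ incident a s.1.1]| <= #|[set t | step s t]|)%N.
Proof.
case: s => [[a m] c] /= lab_s.
apply: leq_trans (leq_imset_card (fun t => t.1.1) _).
apply: subset_leq_card; apply/fintype.subsetP => a'; rewrite inE => a'a.
have [m' [c' st]] := step_outside_line lab_s a'a.
by apply/imsetP; exists (a', m', c'); rewrite ?inE.
Qed.

(** A predecessor [(b, n, d)] of [(a, m, c)] is determined by [b]: its middle label [n] is the meet
    of [b] and [c], and two labels determine the third. The line [b] misses [a], since otherwise it
    would share two points with [c]. *)
Lemma in_degree t : labelling t ->
  (#|[set s | labelling s && step s t]| <= #|[set c | ~~ incident t.1.1 c]|)%N.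
Proof.
case: t => [[a m] c] /= lab_t.
rewrite -(card_in_imset (f := fun s => s.1.1)).
  apply: subset_leq_card; apply/fintype.subsetP => _ /imsetP[[[b n] d] + ->] /=.
  rewrite !inE /step /= => /andP[/labP[bd nb dn] /and4P[_ nc cb an]].
  apply: contraNN cb => ab; case/labP: lab_t => ac _ _.
  by apply/eqP; exact: join_uniq an ac nc ab nb.
move=> [[b n] d] [[b' n'] d'] /=; rewrite !inE /step /=.
case/andP=> lab_s /and4P[_ nc cb an] /andP[lab_s' /and4P[_ n'c cb' an']] e.
rewrite -e in lab_s' cb' *.
have [bd nb dn] := labP lab_s; have [_ n'b _] := labP lab_s'.
have nn' : n = n' by exact: meet_uniq cb nc nb n'c n'b.
rewrite -nn' in lab_s' *.
have dd' : d = d' by exact: lab_uniq (lab_cycle lab_s) (lab_cycle lab_s').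
by rewrite dd'.
Qed.

Lemma degree_le a p :
  (#|[set c | ~~ incident p c]| <= #|[set b | ~~ incident b a]|)%N.
Proof.
have -> : [set c | ~~ incident p c] = ~: [set c | incident p c].
  by apply/setP => c; rewrite !inE.
have -> : [set b | ~~ incident b a] = ~: [set b | incident b a].
  by apply/setP => c; rewrite !inE.
rewrite [X in (X <= _)%N]cardsCs [X in (_ <= X)%N]cardsCs !finset.setCK.
by apply: leq_sub2l; exact: card_range_le_pencil_all.
Qed.

(** * Sets of labellings closed under steps *)

Section Closed.
Variable S : {set K * K * K}.
Hypotheses (S_lab : forall s, s \in S -> labelling s) (S_nonempty : S != finset.set0)
  (S_step : forall s t, s \in S -> step s t -> t \in S).

Lemma closed_backward s t : labelling s -> t \in S -> step s t -> s \in S.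
Proof.
move=> lab_s tS st; case/finset.set0Pn: S_nonempty => s0 s0S.
(* Predecessors are counted among labellings only. As a maximum, [D] bounds all in-degrees from
   above; by [degree_le] it bounds the out-degrees from below. *)
pose step' s t := labelling s && step s t.
pose D := (\max_p #|[set c | ~~ incident p c]|)%N.
apply: (@forward_closed_backward_closed _ step' S D _ _ _ _ t) => //.
- by move=> u v uS /andP[_]; exact: S_step.
- move=> u uS; have -> : [set v | step' u v] = [set v | step u v].
    by apply/setP => v; rewrite !inE /step' S_lab.
  apply: leq_trans (out_degree (S_lab uS)).
  by apply/bigmax_leqP => p _; exact: degree_le.
- move=> v vS; apply: leq_trans (in_degree (S_lab vS)) _.
  exact: (leq_bigmax (F := fun p => #|[set c | ~~ incident p c]|)).
by rewrite /step' lab_s.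
Qed.

(* Labellings with the same middle label have a common successor, so that
   membership in S is a property of the middle label. *)
Lemma closed_middle a c b d m :
  (a, m, c) \in S -> labelling (b, m, d) -> (b, m, d) \in S.
Proof.
(* A step sees the source only through its middle label and the line to be avoided, so a point [x]
   off both [a] and [b] yields a common successor. *)
move=> sS lab_t; have [x /andP[xa xb]] := point_off_lines a b.
have [y [z /and4P[h1 h2 h3 h4]]] := step_outside_line (S_lab sS) xa.
apply: (@closed_backward _ (x, y, z)) => //.
  by apply: S_step sS _; exact/and4P.
apply/and4P; split=> //=; apply: contraNneq xb => <-.
by have [] := labP h1.
Qed.

Definition middle_in (m : K) : Prop :=
  exists a c, (a, m, c) \in S.

Lemma middle_inP a m c : labelling (a, m, c) -> middle_in m <-> (a, m, c) \in S.
Proof.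
by move=> lab_s; split=> [[b [d /closed_middle]]|sS]; [apply | exists a, c].
Qed.

(** A line [b] through [m] other than [c] gives a labelling with middle label [m] that steps to
    [(a, m', c)]; membership passes along this step in both directions. *)
Lemma middle_in_step a m' c m : labelling (a, m', c) -> incident m c -> m != a ->
  middle_in m <-> middle_in m'.
Proof.
move=> lab_t mc ma.
have [b /and3P[mb bc _]] := thick_point m c c.
have [d lab_s] := lab_middle mb.
have st : step (b, m, d) (a, m', c) by apply/and4P; split; rewrite // eq_sym.
rewrite (middle_inP lab_s) (middle_inP lab_t).
by split=> [sS|tS]; [exact: S_step st | exact: closed_backward st].
Qed.

(** With a third point [a] on the join of [x] and [y], both are compared with the same middle label
    [m']. *)
Lemma middle_in_join x y : middle_in x -> middle_in y.
Proof.
have [-> //|xy xS] := eqVneq x y.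
have [c /andP[xc yc]] := join xy.
have [a /and3P[ac ax ay]] := thick_line c x y.
have /existsP[m' lab_t] := ac.
apply/(middle_in_step lab_t yc); first by rewrite eq_sym.
by apply/(middle_in_step lab_t xc); first by rewrite eq_sym.
Qed.

Lemma closed_all s : labelling s -> s \in S.
Proof.
case/finset.set0Pn: S_nonempty => -[[a m] c] sS; case: s => [[a' m'] c'] lab_s.
by apply/(middle_inP lab_s)/(@middle_in_join m); exists a, c.
Qed.
End Closed.

Theorem labelling_path s t : labelling s -> labelling t ->
  exists p, path step s (rcons p t).
Proof.
move=> lab_s lab_t.
(* Starting the search at a successor of [s] yields at least one step even when [s] equals [t]; this
   is what makes $n \ge 2$ possible. *)
have [s1 st1] : exists s1, step s s1.
  case: s lab_s => [[a m] c] lab_s; have [x /andP[xa _]] := point_off_lines a a.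
  by have [y [z st]] := step_outside_line lab_s xa; exists (x, y, z).
have lab_s1 : labelling s1 by case/and4P: st1.
have : t \in [set u | connect step s1 u].
  apply: closed_all lab_t.
  - move=> u; rewrite inE => /connectP[p pp ->].
    elim/last_ind: p pp => [//|p u' _]; rewrite rcons_path last_rcons.
    by case/andP=> _ /and4P[].
  - by apply/finset.set0Pn; exists s1; rewrite inE.
  by move=> u v; rewrite !inE => su uv; apply: connect_trans su (connect1 uv).
rewrite inE => /connectP[p pp ->].
exists (belast s1 p); rewrite -lastI /=.
by rewrite st1.
Qed.
End Labels.

(** * Labels of vertices and walls *)

Section Action.
Variables (V : choiceType) (X : set {fset V}) (A : set (set {fset V}))
  (tau : V -> 'Z_3) (G : groupType) (act : G -> V -> V) (o : V).
Hypotheses (X_complex : simplicial_complex X) (X_vertex : forall v, X [fset v])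
  (A_system : apartment_system X A) (X_locally_finite : locally_finite X)
  (X_thick : thick X) (tau_type : type_function X tau)
  (act_action : group_action act) (act_aut : forall g, automorphism X (act g))
  (act_rotating : forall g, type_rotating tau (act g))
  (act_free : free_action act) (act_transitive : transitive_action act).

Let label := label_set X tau act o.

Lemma actM g h v : act (g * h)%g v = act g (act h v).
Proof. by case: act_action. Qed.

Lemma actV g v : act g^-1%g (act g v) = v.
Proof. by rewrite -actM mulVg; case: act_action. Qed.

Lemma act_orbit_inj g h : act g o = act h o -> g = h.
Proof.
move=> e; have /act_free : act (h^-1 * g)%g o = o by rewrite actM e actV.
by move/(congr1 (fun x => h * x)%g); rewrite mulVKg mulg1.
Qed.

Lemma act_adjacent g u v : adjacent X (act g u) (act g v) <-> adjacent X u v.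
Proof.
have [/bij_inj gI gX] := act_aut g.
by have := gX [fset u; v]; rewrite imfset2 /adjacent (inj_eq gI) => ->.
Qed.

Lemma act_type g v : tau (act g v) = tau v + (tau (act g o) - tau o).
Proof.
have [i gi] := act_rotating g.
by rewrite !gi; congr (_ + _); rewrite addrAC subrr add0r.
Qed.

(** Translation by [g] moves the edge from [o] to the edge from [g o], and shifts the types of both
    ends equally. *)
Lemma label_edge g h :
  label (g^-1 * h)%g <->
  adjacent X (act h o) (act g o) /\ tau (act h o) = tau (act g o) + 1.
Proof.
have -> : label (g^-1 * h)%g <-> adjacent X (act (g^-1 * h)%g o) o /\
    tau (act (g^-1 * h)%g o) = tau o + 1 by [].
rewrite -(act_adjacent g) -actM mulVKg.
have -> : tau (act (g^-1 * h)%g o) = tau (act h o) - tau (act g o) + tau o.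
  by have := act_type g (act (g^-1 * h)%g o); rewrite -actM mulVKg => ->; ring.
split=> -[adj e]; split=> //; last by rewrite e; ring.
by move: e; rewrite [_ + tau o]addrC => /addrI <-; ring.
Qed.

Lemma label1 x : label x <-> adjacent X (act x o) o /\ tau (act x o) = tau o + 1.
Proof. by []. Qed.

Lemma labelV x : label x <->
  adjacent X (act x^-1%g o) o /\ tau (act x^-1%g o) = tau o - 1.
Proof.
have act1 : act 1%g o = o by case: act_action.
have := label_edge x^-1 1; rewrite invgK mulg1 act1 => ->.
split=> -[/adjacent_sym adj e]; split=> //; last by rewrite e; ring.
by rewrite e; ring.
Qed.

(** By freeness, [x] is determined by the simplex formed by [o] and [x o], and only finitely many
    simplices contain [o]. *)
Lemma label_finite : finite_set label.
Proof.
pose F x := [fset o; act x o].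
have : finite_set (F @^-1` [set s | X s /\ o \in s])%classic.
  apply: finite_preimage (X_locally_finite o) => x y _ _ /fsetP eF.
  apply: act_orbit_inj; have := eF (act x o); have := eF (act y o).
  rewrite !in_fset2 !eqxx !orbT.
  case/orP => [/eqP yo|/eqP-> //]; case/esym/orP => [/eqP xo|/eqP-> //].
  by rewrite xo yo.
apply: sub_finite_set => x [[_ Xx] _]; split; last by rewrite in_fset2 eqxx.
by rewrite /F fsetUC.
Qed.

Definition triangle_label (x y z : G) : Prop :=
  [/\ label x, label y, label z & (x * y * z = 1)%g].

(* In the link of o, the label a is the point a o and the label c the line
   c^-1 o. *)
Lemma incident_adjacent a c : label a -> label c ->
  (exists x, triangle_label a x c) <-> adjacent X (act a o) (act c^-1%g o).
Proof.
move=> la lc; have [_ ta] := (label1 a).1 la; have [_ tc] := (labelV c).1 lc.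
have {ta tc}e : tau (act c^-1%g o) = tau (act a o) + 1.
  rewrite ta tc -!addrA; congr (_ + _); exact/val_inj.
split=> [[x [_ lx _ axc]]|adj].
  suff xE : x = (a^-1 * c^-1)%g.
    by move: lx; rewrite xE => /label_edge[/adjacent_sym].
  by apply: (mulgI a); rewrite mulVKg; apply: (mulIg c); rewrite axc mulVg.
exists (a^-1 * c^-1)%g; split=> //; last by rewrite mulVKg mulVg.
by apply/label_edge; split=> //; exact: adjacent_sym.
Qed.

Lemma Z3_cases (x y : 'Z_3) : x != y -> x = y + 1 \/ x = y - 1.
Proof.
move=> xy; suff /orP[/eqP|/eqP] : (x == y + 1) || (x == y - 1) by [left|right].
by case: x y xy => [[|[|[|?]]] ?] [[|[|[|?]]] ?].
Qed.

Lemma neighbour_label w : adjacent X w o ->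
  (tau w = tau o + 1 /\ exists2 x, label x & w = act x o) \/
  (tau w = tau o - 1 /\ exists2 x, label x & w = act x^-1%g o).
Proof.
move=> wo; have := adjacent_type X_vertex A_system tau_type wo.
have [g gw] := act_transitive o w.
case/Z3_cases => tw; [left | right]; split=> //.
  by exists g => //; apply/label1; rewrite gw.
by exists g^-1%g; [apply/labelV|]; rewrite invgK gw.
Qed.

Lemma chamber_third u v c : adjacent X u v -> chamber X c -> [fset u; v] `<=` c ->
  exists2 w, triangle X u v w & c = [fset u; v; w].
Proof.
move=> uv [Xc c3] uvc; have [uv' _] := uv.
have /eqP/cardfs1P[w cw] : #|` c `\` [fset u; v]| = 1%N.
  by rewrite cardfsDS // c3 cardfs2 uv'.
have [wu wv wc] : [/\ w != u, w != v & w \in c].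
  have : w \in c `\` [fset u; v] by rewrite cw in_fset1.
  by rewrite in_fsetD in_fset2 negb_or => /andP[/andP[-> ->] ->].
have cE : c = [fset u; v; w] by rewrite -cw -{1}(fsetID [fset u; v] c) (fsetIidPr uvc).
exists w => //.
have face x : x \in c -> x != w -> adjacent X x w.
  move=> xc xw; split=> //; case: X_complex => _ /(_ _ _ Xc); apply.
    by apply/fsubsetP => y /fset2P[] ->.
  by apply/fset0Pn; exists x; rewrite in_fset2 eqxx.
by split=> //; apply: face; rewrite 1?eq_sym // cE !inE eqxx ?orbT.
Qed.

(** Thickness gives three distinct third vertices, of which [x] and [y] exclude at most two. *)
Lemma thick_triangle u v x y : adjacent X u v ->
  exists w, [/\ triangle X u v w, w != x & w != y].
Proof.
move=> uv; have [uv' Xuv] := uv.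
have [|c1 [c2 [c3 [[h1 h2 h3] [[s1 s2 s3] [d12 d13 d23]]]]]] :=
    X_thick (e := [fset u; v]).
  by split; rewrite ?cardfs2 ?uv'.
have [w1 t1 e1] := chamber_third uv h1 s1.
have [w2 t2 e2] := chamber_third uv h2 s2.
have [w3 t3 e3] := chamber_third uv h3 s3.
have {d12}n12 : w1 != w2 by apply: contraNneq d12 => e; rewrite e1 e2 e.
have {d13}n13 : w1 != w3 by apply: contraNneq d13 => e; rewrite e1 e3 e.
have {d23}n23 : w2 != w3 by apply: contraNneq d23 => e; rewrite e2 e3 e.
have [x1|x1] := eqVneq w1 x; have [y1|y1] := eqVneq w1 y;
  have [x2|x2] := eqVneq w2 x; have [y2|y2] := eqVneq w2 y;
  try by [exists w1 | exists w2];
  exists w3; split=> //; try by rewrite -?x1 -?x2 -?y1 -?y2 eq_sym.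
all: by move: n12; rewrite ?x1 ?x2 ?y1 ?y2 eqxx.
Qed.

(** Transfers [labelling_path] to the group: the labels form a finite type, and the axioms of a
    thick projective plane are read off from the link of [o]. *)
Lemma label_path s t :
  triangle_label s.1.1 s.1.2 s.2 -> triangle_label t.1.1 t.1.2 t.2 ->
  exists (n : nat) (q : nat -> G * G * G), [/\ q 0%N = s, q n.+1 = t &
    forall i, (i <= n)%N -> [/\ triangle_label (q i.+1).1.1 (q i.+1).1.2 (q i.+1).2,
      exists x, triangle_label (q i).1.2 x (q i.+1).2,
      (q i.+1).2 != (q i).1.1 & (q i.+1).1.1 != (q i).1.2]].
Proof.
have /finite_fsetP[P PE] := label_finite.
have inP x : label x <-> x \in P by rewrite PE.
pose K : finType := P.
have labelK (x : K) : label (\val x) by apply/inP/fsvalP.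
have toK x : label x -> exists k : K, x = \val k.
  by move/inP => xP; exists [` xP].
pose lab (x y z : K) := (\val x * \val y * \val z == 1)%g.
have labE x y z : lab x y z <-> triangle_label (\val x) (\val y) (\val z).
  by split=> [/eqP|[_ _ _ /eqP]].
have incE a c : incident lab a c <-> adjacent X (act (\val a) o) (act (\val c)^-1%g o).
  rewrite -incident_adjacent //; split=> [/existsP[x /labE] | [x xl]].
    by exists (\val x).
  have [k kE] : exists k : K, x = \val k by case: xl => _ /toK.
  by apply/existsP; exists k; apply/labE; rewrite -kE.
have pt (a : K) := (label1 _).1 (labelK a).
have ln (a : K) := (labelV _).1 (labelK a).
have ptI (a b : K) : act (\val a) o = act (\val b) o -> a = b.
  by move/act_orbit_inj/val_inj.
have lnI (a b : K) : act (\val a)^-1%g o = act (\val b)^-1%g o -> a = b.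
  by move/act_orbit_inj/invg_inj/val_inj.
have type := adjacent_type X_vertex A_system tau_type.
have asPt w : adjacent X w o -> tau w != tau o - 1 ->
    exists a : K, w = act (\val a) o.
  case/neighbour_label => [[_ [x /toK[k ->]]]|[-> _]]; last by rewrite eqxx.
  by exists k.
have asLn w : adjacent X w o -> tau w != tau o + 1 ->
    exists a : K, w = act (\val a)^-1%g o.
  case/neighbour_label => [[-> _]|[_ [x /toK[k ->]]]]; first by rewrite eqxx.
  by exists k.
have lab_cycle x y z : lab x y z -> lab y z x.
  move/eqP => e; apply/eqP; apply: (mulgI (\val x)).
  by rewrite !mulgA e mul1g mulg1.
have lab_uniq a c x y : lab a x c -> lab a y c -> x = y.
  by move=> /eqP axc /eqP; rewrite -axc => /mulIg/mulgI/val_inj.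
(* Two points have the same type, hence a common neighbour in the link; its type differs from
   theirs, so it is a line. *)
have join a b : a != b -> exists c, incident lab a c && incident lab b c.
  move=> ab; have [pa ta] := pt a; have [pb tb] := pt b.
  have [||||w [oaw obw]] := common_neighbour X_vertex A_system tau_type
    (o := o) (u := act (\val a) o) (v := act (\val b) o).
  - by apply: contraNneq ab => /ptI ->.
  - by rewrite ta tb.
  - exact: adjacent_sym.
  - exact: adjacent_sym.
  case: oaw obw => _ ow aw [_ _ bw].
  have [||c e] := asLn w; first exact: adjacent_sym.
    by rewrite -ta eq_sym; exact: type.
  by exists c; apply/andP; split; apply/incE; rewrite -e.
have meet c d : c != d -> exists a, incident lab a c && incident lab a d.
  move=> cd; have [pc tc] := ln c; have [pd td] := ln d.
  have [||||w [ocw odw]] := common_neighbour X_vertex A_system tau_type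
    (o := o) (u := act (\val c)^-1%g o) (v := act (\val d)^-1%g o).
  - by apply: contraNneq cd => /lnI ->.
  - by rewrite tc td.
  - exact: adjacent_sym.
  - exact: adjacent_sym.
  case: ocw odw => _ ow cw [_ _ dw].
  have [||a e] := asPt w; first exact: adjacent_sym.
    by rewrite -tc eq_sym; exact: type.
  by exists a; apply/andP; split; apply/incE; rewrite -e; exact: adjacent_sym.
have flag a c : incident lab a c -> triangle X o (act (\val a) o) (act (\val c)^-1%g o).
  move/incE => ac; have [pa _] := pt a; have [pc _] := ln c.
  by split=> //; exact: adjacent_sym.
have join_uniq a b c d : a != b -> incident lab a c -> incident lab b c ->
    incident lab a d -> incident lab b d -> c = d.
  move=> ab /flag ac /flag bc /flag ad /flag bd; apply: lnI.
  apply: (common_neighbour_unique X_vertex A_system _ ac bc ad bd).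
  by apply: contraNneq ab => /ptI ->.
have thick_line c x y : exists z, [&& incident lab z c, z != x & z != y].
  have [pc tc] := ln c.
  have [w [[_ ow cw] wx wy]] :=
    thick_triangle (act (\val x) o) (act (\val y) o) (adjacent_sym pc).
  have [||z e] := asPt w; first exact: adjacent_sym.
    by rewrite -tc eq_sym; exact: type.
  exists z; apply/and3P; split; first by apply/incE; rewrite -e; exact: adjacent_sym.
    by apply: contraNneq wx => <-; rewrite e.
  by apply: contraNneq wy => <-; rewrite e.
have thick_point a c d : exists e, [&& incident lab a e, e != c & e != d].
  have [pa ta] := pt a.
  have [w [[_ ow aw] wc wd]] :=
    thick_triangle (act (\val c)^-1%g o) (act (\val d)^-1%g o) (adjacent_sym pa).
  have [||z e] := asLn w; first exact: adjacent_sym.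
    by rewrite -ta eq_sym; exact: type.
  exists z; apply/and3P; split; first by apply/incE; rewrite -e.
    by apply: contraNneq wc => <-; rewrite e.
  by apply: contraNneq wd => <-; rewrite e.
case: s t => [[s1 s2] s3] [[t1 t2] t3] /= ls lt.
have [ks1 s1E] : exists k : K, s1 = \val k by case: ls => /toK.
have [ks2 s2E] : exists k : K, s2 = \val k by case: ls => _ /toK.
have [ks3 s3E] : exists k : K, s3 = \val k by case: ls => _ _ /toK.
have [kt1 t1E] : exists k : K, t1 = \val k by case: lt => /toK.
have [kt2 t2E] : exists k : K, t2 = \val k by case: lt => _ /toK.
have [kt3 t3E] : exists k : K, t3 = \val k by case: lt => _ _ /toK.
subst s1 s2 s3 t1 t2 t3.
have [p] := labelling_path lab_cycle lab_uniq join meet join_uniq thick_line thick_point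
  (s := (ks1, ks2, ks3)) (t := (kt1, kt2, kt3)) ((labE _ _ _).2 ls) ((labE _ _ _).2 lt).
set s := (ks1, ks2, ks3); set t := (kt1, kt2, kt3) => /(pathP s) pp.
pose r (u : K * K * K) := (\val u.1.1, \val u.1.2, \val u.2).
exists (size p), (fun i => r (nth s (s :: rcons p t) i)); split=> //=.
  by rewrite nth_rcons ltnn eqxx.
move=> i ip; have := pp i; rewrite size_rcons ltnS => /(_ ip).
move=> /and4P[/labE h1 /existsP[x /labE h2] h3 h4].
by split=> //; exists (\val x).
Qed.

Lemma label_adjacent g x : label x -> adjacent X (act (g * x)%g o) (act g o).
Proof. by move=> lx; case: ((label_edge g (g * x)%g).1 _) => //; rewrite mulKg. Qed.

(** * The strip of vertices traced by a walk *)

Section Walk.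
Variable q : nat -> G * G * G.

Fixpoint walk (i : nat) : G := if i is j.+1 then (walk j * (q j).1.1)%g else 1%g.

(** Ordered like [zig]: vertices [2i], [2i+1], [2i+2] form the triangle labelled [q i], and the next
    three consecutive vertices form the inverted triangle between [q i] and [q i.+1]. *)
Definition strip (k : nat) : G :=
  if odd k then (walk k./2.+1 * (q k./2).1.2)%g else walk k./2.

Lemma strip_even i : strip i.*2 = walk i.
Proof. by rewrite /strip odd_double doubleK. Qed.

Lemma strip_odd i : strip i.*2.+1 = (walk i.+1 * (q i).1.2)%g.
Proof. by rewrite /strip /= odd_double uphalf_double. Qed.

Lemma nat_even_odd k : (exists i, k = i.*2) \/ (exists i, k = i.*2.+1).
Proof. by rewrite -[k]odd_double_half; case: odd; [right | left]; exists k./2. Qed.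

Variable n : nat.
Hypotheses (q_label : forall i, (i <= n)%N ->
    triangle_label (q i).1.1 (q i).1.2 (q i).2)
  (q_step : forall i, (i < n)%N -> [/\
      exists x, triangle_label (q i).1.2 x (q i.+1).2,
      (q i.+1).2 != (q i).1.1 & (q i.+1).1.1 != (q i).1.2]).

(** Since the three labels multiply to 1, the apex is also reached by going up the left edge against
    its direction. *)
Lemma strip_apex i : (i <= n)%N -> strip i.*2.+1 = (walk i * (q i).2^-1)%g.
Proof.
move=> /q_label[_ _ _ e]; rewrite strip_odd /= -mulgA; congr (_ * _)%g.
by apply: (mulIg (q i).2); rewrite e mulVg.
Qed.

(** Upright triangles come from the labellings and inverted ones from the label [x] of a step, the
    upper edge. The two inequalities of a step forbid folding at even and at odd indices
    respectively. *)
Lemma strip_zigzag : zigzag X (fun k => act (strip k) o) n.*2.+2.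
Proof.
have adjV g x : label x -> adjacent X (act g o) (act (g * x^-1)%g o).
  by move/(@label_adjacent (g * x^-1)%g); rewrite -mulgA mulVg mulg1.
split=> k; case: (nat_even_odd k) => -[i ->] kn.
- have lei : (i <= n)%N by lia.
  have [l1 l2 l3 _] := q_label lei.
  rewrite -doubleS !strip_even; split.
  + by rewrite strip_apex //; exact: adjV.
  + by apply: adjacent_sym; exact: label_adjacent.
  + by rewrite strip_odd; exact: label_adjacent.
- have lti : (i < n)%N by lia.
  have [_ l2 _ _] := q_label (ltnW lti); have [_ _ l3 _] := q_label lti.
  have [[x [_ lx _ e]] _ _] := q_step lti.
  rewrite -!doubleS strip_even [strip i.+1.*2.+1]strip_apex // strip_odd; split.
  + exact: label_adjacent.
  + have -> : (walk i.+1 * (q i.+1).2^-1 = walk i.+1 * (q i).1.2 * x)%g.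
      by rewrite -[RHS]mulgA; congr (_ * _)%g; apply: (mulIg (q i.+1).2); rewrite mulVg e.
    by apply: adjacent_sym; exact: label_adjacent.
  + exact: adjV.
- have lti : (i < n)%N by lia.
  have [_ neq _] := q_step lti.
  rewrite -doubleS strip_even strip_apex //; apply: contraNneq neq => /act_orbit_inj e.
  apply/eqP; apply: (mulgI (walk i)).
  by rewrite {1}e -mulgA mulVg mulg1.
- have lti : (i < n)%N by lia.
  have [_ _ neq] := q_step lti.
  rewrite -!doubleS strip_even strip_odd.
  apply: contraNneq neq => /act_orbit_inj /mulgI e.
  by rewrite -e.
Qed.

Lemma strip_triangle i : (i <= n)%N ->
  [/\ strip i.+1.*2 = (strip i.*2 * (q i).1.1)%g,
      strip i.*2.+1 = (strip i.+1.*2 * (q i).1.2)%g &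
      strip i.*2 = (strip i.*2.+1 * (q i).2)%g].
Proof.
move=> lei; rewrite !strip_even strip_odd; split=> //.
by rewrite -strip_odd strip_apex // -mulgA mulVg mulg1.
Qed.
End Walk.
End Action.

Theorem theorem1p3 (V : choiceType) (X : set {fset V}) (tau : V -> 'Z_3)
    (G : groupType) (act : G -> V -> V) (o : V)
    (X_building : building_A2 X)
    (X_locally_finite : locally_finite X)
    (X_thick : thick X)
    (tau_type : type_function X tau)
    (act_action : group_action act)
    (act_aut : forall g, automorphism X (act g))
    (act_rotating : forall g, type_rotating tau (act g))
    (act_free : free_action act)
    (act_transitive : transitive_action act)
    (I F : G * G * G)
    (I_labelling : triangle_labellings X tau act o I)
    (F_labelling : triangle_labellings X tau act o F) :
  exists (n : nat) (phi : int * int -> G) (b b2 b3 : nat -> G),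
    (2 <= n)%N /\
    apartment_chart X act o phi /\
    (forall i : nat, (1 <= i <= n)%N ->
       triangle_labellings X tau act o (b i, b2 i, b3 i)) /\
    (b 1%N, b2 1%N, b3 1%N) = I /\
    (b n, b2 n, b3 n) = F /\
    (forall i : nat, (1 <= i <= n)%N ->
       [/\ phi (i%:Z, 0)%R = (phi (i%:Z - 1, 0)%R * b i)%g,
           phi (i%:Z - 1, 1)%R = (phi (i%:Z, 0)%R * b2 i)%g &
           phi (i%:Z - 1, 0)%R = (phi (i%:Z - 1, 1)%R * b3 i)%g]).
Proof.
case: X_building => X_complex X_vertex [A A_system].
have I_lab : triangle_label X tau act o I.1.1 I.1.2 I.2.
  by case: I I_labelling => [[]].
have F_lab : triangle_label X tau act o F.1.1 F.1.2 F.2.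
  by case: F F_labelling => [[]].
have [m [q [q0 qm q_step]]] := label_path X_complex X_vertex A_system
  X_locally_finite X_thick tau_type act_action act_aut act_rotating act_free
  act_transitive I_lab F_lab.
have q_label i : (i <= m.+1)%N -> triangle_label X tau act o (q i).1.1 (q i).1.2 (q i).2.
  by case: i => [|i] im; [rewrite q0 | case: (q_step i im)].
have strip_z : zigzag X (fun k => act (strip q k) o) m.+1.*2.+2.
  apply: strip_zigzag q_label _ => // i im; by case: (q_step i im).
have [f [S AS fI] fk] := zigzag_chart X_vertex A_system strip_z.
(* Transitivity lifts the chart to the group; freeness then identifies the lift with the strip along
   the row. *)
have /choice[phi phiE] : forall k, exists g, act g o = f k.
  by move=> k; exact: act_transitive.
have phi_zig k : (k <= m.+1.*2.+2)%N -> phi (zig k) = strip q k.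
  by move=> km; apply: (act_orbit_inj (o := o) act_action act_free); rewrite phiE fk.
(* The [m.+2] labellings [q 0] to [q m.+1] are renumbered from 1. *)
exists m.+2, phi, (fun i => (q i.-1).1.1), (fun i => (q i.-1).1.2), (fun i => (q i.-1).2).
split=> //; split.
  exists S; split; first by exists A.
  by have -> : (fun k => act (phi k) o) = f by apply/funext.
split; first by case=> [//|i] /= im; exact: q_label.
split; first by rewrite /= q0; case: (I) => [[]].
split; first by rewrite /= qm; case: (F) => [[]].
case=> [//|i] /= im; have lei : (i <= m.+1)%N by [].
have zig_even j : zig j.*2 = (j%:Z, 0) by rewrite -[j.*2]addn0 (zigE j false).
have zig_odd j : zig j.*2.+1 = (j%:Z, 1) by rewrite -addn1 (zigE j true).
have -> : i.+1%:Z - 1 = i%:Z by lia.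
rewrite -!zig_even -!zig_odd !phi_zig ?ltnS ?leq_double //; try by lia.
exact: (strip_triangle q_label lei).
Qed.
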